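(* Assume there exists $\gamma>0$ such that the propensities satisfy $p^{\sigma_{q,g}^f(j)}>\gamma$ for all $g\in\mathcal G$, all queries $q\in\mathcal Q$ (and all relevance vectors), and all $j\in\{1,\dots,t_g^{\max}\}$. Let $m>1$ be the number of logged requests. Then for any $\lambda>0$, $g\in\mathcal G$, $t\in\{1,\dots,t_g^{\max}-1\}$ and $\alpha\in(0,1)$, with probability at least $1-\alpha$, $$U_g(t)\ \ge\ \hat U_{g,\lambda}^{\mathrm{CIPW}}(t)-\sqrt{\frac{2V_m(\mathbf Z^{g,t})\ln(2/\alpha)}{m}}-\frac{7t\lambda\ln(2/\alpha)}{3(m-1)},$$ where $\mathbf Z^{g,t}=(Z_i^{g,t})_{i=1}^m$ with $$Z_i^{g,t}=\sum_{j=1}^t\min\Big(\lambda,\frac1{p_i^{\sigma_{Q_i,g}^f(j)}}\Big)C_i^{\sigma_{Q_i,g}^f(j)},\qquad \hat U_{g,\lambda}^{\mathrm{CIPW}}(t)=\frac1m\sum_{i=1}^m Z_i^{g,t},$$ $$V_m(\mathbf Z^{g,t})=\frac1{m(m-1)}\sum_{1\le i<j\le m}\big(Z_i^{g,t}-Z_j^{g,t}\big)^2 .$$ (The right-hand side of the inequality is denoted $\hat U_g^-(t,\alpha)$.)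
   Context: There are $n$ items $d^1,\dots,d^n$ in an item space $\mathcal D$, and a family $\mathcal G$ of (possibly overlapping) groups of items. A recommendation request is a pair $(q,\mathbf r)$ drawn from a distribution $P_{Q,\mathbf R}$, where $q\in\mathcal Q$ is a query and $\mathbf r=(r^1,\dots,r^n)\in\{0,1\}^n$ is the vector of relevances of the items. A relevance model $f:\mathcal Q\times\mathcal D\to[0,1]$ is fixed. For a query $q$ and group $g$, $\sigma_{q,g}^f$ is a deterministic ranking of the items of $g$ by decreasing value of $f(q,\cdot)$; $\sigma_{q,g}^f(j)$ is the index of the item of $g$ ranked at position $j$. For each $g$, $t_g^{\max}$ is a positive integer (at most the number of items in $g$). For $t\in\{0,1,\dots,t_g^{\max}\}$, $$U_g(t):=\mathbb E_{(q,\mathbf r)\sim P_{Q,\mathbf R}}\Big[\sum_{j=1}^{t} r^{\sigma_{q,g}^f(j)}\Big].$$ Logged data: for a fixed logging policy $\pi_0$, for each $i\in\{1,\dots,m\}$, independently, $(Q_i,\mathbf R_i)\sim P_{Q,\mathbf R}$, and a user observation vector $\mathbf O_i=(O_i^1,\dots,O_i^n)\in\{0,1\}^n$ is drawn from a conditional distribution $P^{\pi_0}_{\mathbf O\mid Q,\mathbf R}$ given $(Q_i,\mathbf R_i)$ (the same for all $i$). The user feedback on item $j$ is $C_i^j=O_i^jR_i^j$. The propensity is $p_i^j:=\Pr(O_i^j=1\mid Q_i,\mathbf R_i;\pi_0)$, a function of $(Q_i,\mathbf R_i)$ which is assumed known. In the positivity assumption, $p^{j}$ denotes the propensity of item $j$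 for a generic request. *)

(* Defs.v *)
From HB Require Import structures.
From mathcomp Require Import all_boot all_order all_algebra.
From mathcomp Require Import all_classical all_reals all_analysis.

Set Implicit Arguments.
Unset Strict Implicit.
Unset Printing Implicit Defensive.
Import Order.TTheory GRing.Theory Num.Theory.

Local Open Scope classical_set_scope.
Local Open Scope ring_scope.

(* The items are indexed by 'I_n; a vector of {0,1}^n is an n.-tuple bool, with
   the product sigma-algebra (here: every subset is measurable). *)
Definition request (Q : Type) (n : nat) : Type := (Q * n.-tuple bool)%type.

(* A logged request ((q, r), o), with o the user observations. *)
Definition log_entry (Q : Type) (n : nat) : Type :=
  (request Q n * n.-tuple bool)%type.

(* As in the usual notation sigma(1), sigma(2), ..., positions start at 1;
   the values of [s] outside 1, ..., #|g| are irrelevant. Ties in the score may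
   be broken in any way. *)
Definition is_ranking (R : realType) (n : nat) (score : 'I_n -> R)
    (g : {set 'I_n}) (s : nat -> 'I_n) : Prop :=
  perm_eq [seq s j | j <- iota 1 #|g|] (enum g) /\
  forall j k : nat, (1 <= j)%N -> (j <= k)%N -> (k <= #|g|)%N ->
    score (s k) <= score (s j).

Definition utility (R : realType) (n : nat) d (Q : measurableType d)
    (PQR : probability (Q * n.-tuple bool)%type R)
    (sigma : Q -> nat -> 'I_n) (t : nat) : \bar R :=
  'E_PQR[fun x : request Q n =>
           (\sum_(1 <= j < t.+1) (tnth x.2 (sigma x.1 j))%:R)%R]%E.

(* Pr(O^j = 1 | Q = x.1, R = x.2), where [PO] is the conditional distribution
   of the observations induced by the logging policy. *)
Definition propensity (R : realType) (n : nat) d (Q : measurableType d)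
    (PO : R.-pker (Q * n.-tuple bool) ~> (n.-tuple bool))
    (x : request Q n) (j : 'I_n) : R :=
  fine (PO x [set o : n.-tuple bool | tnth o j]).

(* [X] consists of a request drawn from [PQR], followed by observations drawn
   from [PO] given that request. *)
Definition has_log_law (R : realType) (n : nat) d (Q : measurableType d)
    (PQR : probability (Q * n.-tuple bool)%type R)
    (PO : R.-pker (Q * n.-tuple bool) ~> (n.-tuple bool))
    dT (T : measurableType dT) (P : probability T R)
    (X : {RV P >-> ((Q * n.-tuple bool) * n.-tuple bool)%type}) : Prop :=
  forall (A : set (Q * n.-tuple bool)) (B : set (n.-tuple bool)),
    measurable A -> measurable B ->
    P (X @^-1` (A `*` B)) = (\int[PQR]_(x in A) PO x B)%E.

Definition mutually_independent (R : realType) dT (T : measurableType dT)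
    (P : probability T R) dE (E : measurableType dE) (I : finType)
    (X : I -> {RV P >-> E}) : Prop :=
  forall (J : {set I}) (A : I -> set E),
    (forall i, i \in J -> measurable (A i)) ->
    P [set w | forall i, i \in J -> A i (X i w)] =
    (\prod_(i in J) P (X i @^-1` A i))%E.

Definition feedback (R : realType) (Q : Type) (n : nat) (e : log_entry Q n)
    (j : 'I_n) : R :=
  (tnth e.2 j)%:R * (tnth e.1.2 j)%:R.

Definition Zstat (R : realType) (n : nat) d (Q : measurableType d)
    (PO : R.-pker (Q * n.-tuple bool) ~> (n.-tuple bool))
    (sigma : Q -> nat -> 'I_n) (lambda : R) (t : nat) (e : log_entry Q n) : R :=
  \sum_(1 <= j < t.+1)
    Num.min lambda (1 / propensity PO e.1 (sigma e.1.1 j)) *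
    feedback R e (sigma e.1.1 j).

Definition sample_mean (R : realType) (m : nat) (z : 'I_m -> R) : R :=
  m%:R^-1 * \sum_(i < m) z i.

Definition sample_variance (R : realType) (m : nat) (z : 'I_m -> R) : R :=
  (m%:R * (m%:R - 1))^-1 *
  \sum_(i < m) \sum_(j < m | (i < j)%N) (z i - z j) ^+ 2.

Definition U_CIPW (R : realType) (n : nat) d (Q : measurableType d)
    (PO : R.-pker (Q * n.-tuple bool) ~> (n.-tuple bool))
    (sigma : Q -> nat -> 'I_n) (lambda : R) (t m : nat)
    (e : 'I_m -> log_entry Q n) : R :=
  sample_mean (fun i => Zstat PO sigma lambda t (e i)).

Definition U_lower (R : realType) (n : nat) d (Q : measurableType d)
    (PO : R.-pker (Q * n.-tuple bool) ~> (n.-tuple bool))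
    (sigma : Q -> nat -> 'I_n) (lambda : R) (t : nat) (alpha : R) (m : nat)
    (e : 'I_m -> log_entry Q n) : R :=
  U_CIPW PO sigma lambda t e
  - Num.sqrt (2 * sample_variance (fun i => Zstat PO sigma lambda t (e i)) *
              ln (2 / alpha) / m%:R)
  - 7 * t%:R * lambda * ln (2 / alpha) / (3 * (m%:R - 1)).

(* Main.v *)
Require Import Defs.
From HB Require Import structures.
From mathcomp Require Import all_boot all_order all_algebra.
From mathcomp Require Import fingroup perm.
From mathcomp Require Import all_classical all_reals all_analysis.
From mathcomp Require Import measurable_realfun.
From mathcomp Require Import ring lra zify.
Set Implicit Arguments.
Unset Strict Implicit.
Unset Printing Implicit Defensive.
Import Order.TTheory GRing.Theory Num.Theory.
Import numFieldNormedType.Exports.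
Local Open Scope classical_set_scope.
Local Open Scope ring_scope.

(** The estimator is conservative: by conditioning on the request, each clipped
    weight [min(lambda, 1/p)] times the propensity [p] is at most 1, so the mean
    of [Z] is at most [U_g(t)]. It remains to prove the empirical Bernstein
    inequality for i.i.d. variables with values in an interval, with
    [L = ln (2 / alpha)].

    Bernstein's inequality controls the sample mean by the true standard
    deviation [sd], up to probability [exp (- L)]. To replace [sd] by the sample
    variance [V], use Hoeffding's device for U-statistics: [V] is the average
    over all permutations of the sample of a mean of [m./2] independent copies
    of [W = (Y - Y')^2 / 2], and by convexity [exp (- th V)] is at most the
    average of the corresponding exponentials. As [0 <= W <= 1/2] gives
    [W^2 <= W / 2], and [2 * m./2 >= m - 1], this yields
    [sd <= sqrt V + sqrt (2 L / (m - 1))] up to probability [exp (- L)]; the two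
    bounds combine to the constant [7/3 = 2 + 1/3]. *)

(** * Elementary inequalities for the exponential *)

Lemma expRN_le_quadratic (R : realType) (x : R) :
  0 <= x -> expR (- x) <= 1 - x + x ^+ 2 / 2.
Proof.
move=> x0; rewrite expRN.
have h : 1 + x + x ^+ 2 / 2 <= expR x.
  have -> : 1 + x + x ^+ 2 / 2 = series (exp_coeff x) 3.
    rewrite /series /= !big_nat_recr //= big_geq // /exp_coeff /=.
    by rewrite expr0 expr1 !factS fact0 /= !muln1 divr1; field.
  apply: (nondecreasing_cvgn_le _ (is_cvg_series_exp_coeff x)).
  by apply/nondecreasing_seqP => k; rewrite /series /= big_nat_recr //= lerDl exp_coeff_ge0.
have p0 : 0 < 1 + x + x ^+ 2 / 2 by nra.
apply: (@le_trans _ _ (1 + x + x ^+ 2 / 2)^-1).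
  by rewrite lef_pV2 // posrE expR_gt0.
rewrite -[leLHS]mul1r ler_pdivrMr //.
(* [(1 + x + x^2/2) (1 - x + x^2/2) = 1 + x^4/4 >= 1]. *)
have := sqr_ge0 (x ^+ 2); lra.
Qed.

Lemma series_exp_coeffSS (R : realType) (x : R) (k : nat) :
  series (exp_coeff x) k.+2 = 1 + x + \sum_(0 <= i < k) exp_coeff x i.+2.
Proof.
rewrite /series /= big_nat_recl // big_nat_recl // /exp_coeff /=.
by rewrite expr0 expr1 !factS fact0 /= !muln1 !divr1 addrA.
Qed.

(** With the terms of degree 0 and 1 split off, the next two estimates become termwise comparisons
    from degree 2 onwards. *)
Lemma expR_cvg_tail (R : realType) (x : R) :
  (fun k : nat => 1 + x + \sum_(0 <= i < k) exp_coeff x i.+2) @ \oo --> expR x.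
Proof.
have := is_cvg_series_exp_coeff x; rewrite -/(expR x) => h.
have : series (exp_coeff x) (k + 2)%N @[k --> \oo] --> expR x.
  by rewrite (cvg_shiftn 2 (series (exp_coeff x))).
apply: cvg_trans; apply: near_eq_cvg; near=> k.
by rewrite addn2 series_exp_coeffSS.
Unshelve. all: by end_near. Qed.

Arguments expR_cvg_tail {R} x.

(** For [k >= 2] and [|w| <= 1] one has [w^k <= w^2], so [w^2] can be pulled out of every term of
    the tail of the series at [th * w]. *)
Lemma expRM_le_quadratic (R : realType) (th w : R) :
  0 <= th -> `|w| <= 1 ->
  expR (th * w) <= 1 + th * w + w ^+ 2 * (expR th - 1 - th).
Proof.
move=> th0 w1.
have h1 := expR_cvg_tail (th * w).
have h2 : (fun k : nat => 1 + th * w + w ^+ 2 *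
   (1 + th + \sum_(0 <= i < k) exp_coeff th i.+2 - 1 - th)) @ \oo -->
   1 + th * w + w ^+ 2 * (expR th - 1 - th).
  apply: cvgD; first exact: cvg_cst.
  apply: cvgM; first exact: cvg_cst.
  apply: cvgB; last exact: cvg_cst.
  apply: cvgB; last exact: cvg_cst.
  exact: expR_cvg_tail.
rewrite -(cvg_lim _ h1)// -(cvg_lim _ h2)//.
apply: ler_lim; [by apply/cvg_ex; eexists; exact: h1|by apply/cvg_ex; eexists; exact: h2|].
apply: nearW => k; rewrite lerD2l.
have -> (a b : R) : 1 + a + b - 1 - a = b by ring.
rewrite mulr_sumr; apply: ler_sum => i _; rewrite /exp_coeff /= mulrA.
rewrite ler_wpM2r // exprMn mulrC.
rewrite ler_wpM2r ?exprn_ge0 //.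
rewrite -addn2 addnC exprD ler_piMr ?sqr_ge0 //.
by rewrite (le_trans (ler_norm _)) // normrX exprn_ile1.
Qed.

(** Since [(i + 2)! >= 2 * 3^i], the tail is dominated by a geometric series of ratio [th / 3]. *)
Lemma expR_tail_le (R : realType) (th : R) : 0 <= th < 3 ->
  expR th - 1 - th <= th ^+ 2 / (2 * (1 - th / 3)).
Proof.
move=> /andP[th0 th3].
have h : expR th <= 1 + th + th ^+ 2 / (2 * (1 - th / 3)); last by lra.
rewrite -(cvg_lim _ (expR_cvg_tail th))//.
apply: limr_le; first by apply/cvg_ex; eexists; exact: expR_cvg_tail.
apply: nearW => k; rewrite lerD2l.
have step i : exp_coeff th i.+2 <= th ^+ 2 / 2 * (th / 3) ^+ i.
  elim: i => [|i ih].
    by rewrite /exp_coeff /= expr0 mulr1 !factS fact0 muln1.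
  have -> : exp_coeff th i.+3 = exp_coeff th i.+2 * (th / i.+3%:R).
    by rewrite /exp_coeff /= factS natrM invfM exprSr [X in _ * X = _]mulrC mulrACA.
  rewrite [(th / 3) ^+ i.+1]exprSr [leRHS]mulrA; apply: ler_pM => //; first exact: exp_coeff_ge0.
    by rewrite divr_ge0.
  by rewrite ler_wpM2l // lef_pV2 ?posrE ?ltr0n // ler_nat.
apply: (@le_trans _ _ (\sum_(0 <= i < k) th ^+ 2 / 2 * (th / 3) ^+ i)).
  by apply: ler_sum => i _; exact: step.
have -> : \sum_(0 <= i < k) th ^+ 2 / 2 * (th / 3) ^+ i =
   series (geometric (th ^+ 2 / 2) (th / 3)) k by [].
have q1 : th / 3 != 1 by rewrite lt_eqF //; lra.
rewrite geometric_seriesE //.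
have c0 : 0 <= th ^+ 2 / 2 / (1 - th / 3).
  by rewrite divr_ge0 ?divr_ge0 ?sqr_ge0 //; lra.
have -> : th ^+ 2 / (2 * (1 - th / 3)) = th ^+ 2 / 2 / (1 - th / 3).
  by rewrite invfM mulrA.
rewrite /= [leLHS]mulrAC ler_piMr // gerBl exprn_ge0 //; lra.
Qed.

(** Jensen's inequality for a uniform mean: bound each [expR (a i)] below by the tangent line at the
    mean [M]; the linear parts sum to 0. *)
Lemma expR_mean_le (R : realType) (I : finType) (a : I -> R) : (0 < #|I|)%N ->
  expR (#|I|%:R^-1 * \sum_i a i) <= #|I|%:R^-1 * \sum_i expR (a i).
Proof.
move=> I0; set M := _ * \sum_i a i.
have N0 : (#|I|%:R : R) != 0 by rewrite pnatr_eq0 -lt0n.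
have h : \sum_(i : I) (expR M * (1 + (a i - M))) <= \sum_i expR (a i).
  apply: ler_sum => i _; rewrite -[in leRHS](subrKC M (a i)) expRD.
  by rewrite ler_wpM2l ?expR_ge0 // expR_ge1Dx.
rewrite ler_pdivlMl ?ltr0n // (le_trans _ h) // -mulr_sumr big_split /= sumrB.
rewrite !sumr_const [X in _ + X](_ : _ = 0).
  by rewrite addr0 mulrC.
by rewrite -mulr_natl /M mulrA divff // mul1r subrr.
Qed.

(** * Integrals of products of independent variables *)

Section weighted.
Local Open Scope ereal_scope.
Import HBNNSimple.

Lemma ge0_integral_weight_nnsfun (R : realType) d1 (T : measurableType d1)
    (mu : {measure set T -> \bar R}) dE (E : measurableType dE) (X : T -> E)
    (G : T -> \bar R) (f : {nnsfun E >-> R}) :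
    measurable_fun setT X -> measurable_fun setT G -> (forall x, 0 <= G x) ->
  \int[mu]_x (G x * (f (X x))%:E) =
  \sum_(r \in range f) r%:E * \int[mu]_x (G x * (\1_(f @^-1` [set r]) (X x))%:E).
Proof.
move=> mX mG G0.
have m1 r : measurable_fun setT (fun x => G x * (\1_(f @^-1` [set r]) (X x))%:E).
  apply: emeasurable_funM => //; apply/measurable_EFinP.
  by apply: (measurableT_comp _ mX); exact: measurable_indic.
transitivity (\int[mu]_x \sum_(r \in range f)
    r%:E * (G x * (\1_(f @^-1` [set r]) (X x))%:E)).
  apply: eq_integral => x _; rewrite fimfunE -fsumEFin// ge0_mule_fsumr.
    by apply: eq_fsbigr => r _; rewrite EFinM muleCA.
  by move=> r; rewrite EFinM nnfun_muleindic_ge0.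
rewrite ge0_integral_fsum//; last 2 first.
  by move=> r; exact: measurable_funeM.
- move=> r x _; rewrite muleCA mule_ge0// -EFinM.
  by rewrite EFinM nnfun_muleindic_ge0.
apply: eq_fsbigr => r; rewrite inE /= => -[y _ <-].
by rewrite ge0_integralZl ?lee_fin// => x _; rewrite mule_ge0// lee_fin.
Qed.

(** Equality on indicators extends to simple functions by linearity and to nonnegative functions by
    monotone convergence. The two sides may have different measures, maps and weights: for
    independence the weight [G] is the product of the other factors and [H] is constant, while for
    the log law [G] is the indicator of an observation vector and [H] its conditional
    probability. *)
Lemma ge0_integral_weight_eq (R : realType)
    d1 (T : measurableType d1) (mu : {measure set T -> \bar R})
    d2 (S : measurableType d2) (nu : {measure set S -> \bar R})
    dE (E : measurableType dE) (X : T -> E) (Y : S -> E)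
    (G : T -> \bar R) (H : S -> \bar R) :
    measurable_fun setT X -> measurable_fun setT Y ->
    measurable_fun setT G -> measurable_fun setT H ->
    (forall x, G x \is a fin_num) -> (forall y, H y \is a fin_num) ->
    (forall x, 0 <= G x) -> (forall y, 0 <= H y) ->
    (forall A, measurable A ->
      \int[mu]_x (G x * (\1_A (X x))%:E) = \int[nu]_y (H y * (\1_A (Y y))%:E)) ->
  forall f : E -> R, measurable_fun setT f -> (forall e, (0 <= f e)%R) ->
    \int[mu]_x (G x * (f (X x))%:E) = \int[nu]_y (H y * (f (Y y))%:E).
Proof.
move=> mX mY mG mH Gfin Hfin G0 H0 GH f mf f0.
have mEf : measurable_fun setT (EFin \o f) by exact/measurable_EFinP.
pose f_ := nnsfun_approx measurableT mEf.
have lim_f d0 (V : measurableType d0) (ka : {measure set V -> \bar R})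
    (K : V -> \bar R) (Z : V -> E) : measurable_fun setT Z ->
    measurable_fun setT K -> (forall x, K x \is a fin_num) ->
    (forall x, 0 <= K x) ->
    \int[ka]_x (K x * (f (Z x))%:E) =
    limn (fun n => \int[ka]_x (K x * (f_ n (Z x))%:E)).
  move=> mZ mK Kfin K0; rewrite -monotone_convergence//.
  - apply: eq_integral => x _; apply/esym/cvg_lim => //; apply: cvgeZl => //.
    by apply: cvg_nnsfun_approx => // e _; rewrite lee_fin.
  - move=> n; apply: emeasurable_funM => //; apply/measurable_EFinP.
    exact: measurableT_comp.
  - by move=> n x _; rewrite mule_ge0// lee_fin.
  - move=> x _ a b ab; rewrite lee_wpmul2l// lee_fin.
    exact/lefP/nd_nnsfun_approx.
rewrite !lim_f//; congr (limn _); apply/funext => n.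
rewrite !ge0_integral_weight_nnsfun//; apply: eq_fsbigr => r _.
by rewrite GH.
Qed.

(* Induction on the number of factors that are not indicator functions. *)
Lemma independent_integral_prod (R : realType) d (T : measurableType d)
    (P : probability T R) dE (E : measurableType dE) (I : finType)
    (X : I -> {RV P >-> E}) (g : I -> E -> R) :
    mutually_independent X ->
    (forall i, measurable_fun setT (g i)) -> (forall i e, (0 <= g i e)%R) ->
    (forall i, \int[P]_w (g i (X i w))%:E < +oo) ->
  \int[P]_w (\prod_i g i (X i w))%:E = \prod_i \int[P]_w (g i (X i w))%:E.
Proof.
move=> indX.
suff h (n : nat) (J : {set I}) : #|J| = n -> forall g : I -> E -> R,
    (forall i, measurable_fun setT (g i)) -> (forall i e, (0 <= g i e)%R) ->
    (forall i, \int[P]_w (g i (X i w))%:E < +oo) ->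
    (forall i, i \notin J -> exists2 A, measurable A & g i = \1_A) ->
    \int[P]_w (\prod_i g i (X i w))%:E = \prod_i \int[P]_w (g i (X i w))%:E.
  by move=> mg g0 gfin; apply: (h _ [set: I]%SET erefl) => // i; rewrite inE.
elim: n J => [|n ih] J cJ {}g mg g0 gfin gJ.
  have J0 : J = finset.set0 by apply/eqP; rewrite -cards_eq0 cJ.
  have /choice[A gA] : forall i, exists A, measurable A /\ g i = \1_A.
    by move=> i; have [|A mA e] := gJ i; [rewrite J0 inE|exists A].
  have mXA i : measurable (X i @^-1` A i).
    by rewrite -[_ @^-1` _]setTI; apply: (measurable_funP (X i)) => //; case: (gA i).
  (* A product of indicators is the indicator of an intersection, to which the definition of
     independence applies. *)
  transitivity (\int[P]_w
      (\1_[set w | forall i, i \in [set: I]%SET -> A i (X i w)] w)%:E).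
    apply: eq_integral => w _; congr EFin; rewrite indicE.
    have [h|h] := boolP (w \in _).
      rewrite big1// => i _; rewrite (gA i).2 indicE mem_set//.
      by move/set_mem : h; apply; rewrite inE.
    have /existsNP[i nA] : ~ forall i, A i (X i w).
      by move=> hA; move/negP : h; apply; apply/mem_set => i _; exact: hA.
    by rewrite (bigD1 i)//= (gA i).2 indicE memNset// mul0r.
  have mXAI : measurable [set w | forall i, i \in [set: I]%SET -> A i (X i w)].
    rewrite (_ : [set w | _] = \bigcap_(i in [set: I]) (X i @^-1` A i)).
      by apply: fin_bigcap_measurable => //; exact: finite_finset.
    by apply/seteqP; split=> w h i _; apply: h; rewrite // finset.inE.
  rewrite integral_indic// setIT.
  apply: etrans (indX [set: I]%SET A _) _; first by move=> i _; case: (gA i).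
  rewrite [LHS](eq_bigl xpredT); last by move=> i; rewrite finset.inE.
  apply: eq_bigr => i _; rewrite (gA i).2 -[P _ in LHS]/(P (X i @^-1` A i)).
  by rewrite -[X in P X]setIT -integral_indic.
have [i0 i0J] : exists i0, i0 \in J by apply/set0Pn; rewrite -card_gt0 cJ.
have int_ge0 i : 0 <= \int[P]_w (g i (X i w))%:E.
  by apply: integral_ge0 => w _; rewrite lee_fin.
pose G w := (\prod_(i | i != i0) g i (X i w))%R.
pose c := \prod_(i | i != i0) \int[P]_w (g i (X i w))%:E.
have c0 : 0 <= c.
  exact: prode_ge0.
rewrite [RHS](bigD1 i0)//= -/c muleC.
transitivity (\int[P]_w (c * (g i0 (X i0 w))%:E)); last first.
  rewrite ge0_integralZl//.
  - by apply/measurable_EFinP; exact: measurableT_comp.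
  - by move=> w _; rewrite lee_fin.
transitivity (\int[P]_w ((G w)%:E * (g i0 (X i0 w))%:E)).
  by apply: eq_integral => w _; rewrite (bigD1 i0)//= EFinM muleC.
apply: (ge0_integral_weight_eq (X := X i0) (Y := X i0)) => //.
- apply/measurable_EFinP; rewrite /G; under eq_fun do rewrite -big_filter.
  by apply: measurable_prod => i _; exact: measurableT_comp.
- by move=> w; apply: prode_fin_num => i _; rewrite ge0_fin_numE.
- by move=> w; rewrite lee_fin prodr_ge0.
- move=> A mA.
  (* By the weighted extension, the factor at [i0] need only be tested on indicators. With [\1_A] in
     its place, one fewer factor is not an indicator, and the induction hypothesis applies. *)
  pose g' i := if i == i0 then \1_A else g i.
  have cJ' : #|(J :\ i0)%SET| = n by move: cJ; rewrite (cardsD1 i0) i0J => -[].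
  have mg' i : measurable_fun setT (g' i) by rewrite /g'; case: ifP.
  have g'0 i e : (0 <= g' i e)%R by rewrite /g'; case: ifP.
  have g'fin i : \int[P]_w (g' i (X i w))%:E < +oo.
    rewrite /g'; case: ifP => // _.
    apply: (@le_lt_trans _ _ (\int[P]_w 1)); last first.
      rewrite integral_cst// mul1e.
      exact: le_lt_trans (probability_le1 P measurableT) (ltry _).
    apply: ge0_le_integral => //.
    - by apply/measurable_EFinP; exact: measurableT_comp.
    - by move=> w _; rewrite lee_fin indicE lern1 leq_b1.
  have g'J i : i \notin (J :\ i0)%SET -> exists2 B, measurable B & g' i = \1_B.
    rewrite finset.in_setD1 negb_and negbK /g'; case: eqP => /= [_ _|_]; last exact: gJ.
    by exists A.
  have := ih _ cJ' _ mg' g'0 g'fin g'J.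
  rewrite (bigD1 i0)//= /g' eqxx.
  under [X in _ = _ * X -> _]eq_bigr => i /negbTE ii0 do rewrite ii0.
  rewrite -/c muleC -ge0_integralZl//; last first.
    by apply/measurable_EFinP; exact: measurableT_comp.
  move=> <-; apply: eq_integral => w _; rewrite (bigD1 i0)//= eqxx EFinM muleC.
  by congr (_ * _)%:E; apply: eq_bigr => i /negbTE ->.
Qed.
End weighted.

(** * Bounded measurable functions on a probability space *)

Definition bounded_measurable (R : realType) d (T : measurableType d)
    (f : T -> R) : Prop :=
  measurable_fun setT f /\ exists M : R, forall x, `|f x| <= M.

Section bounded_measurable.
Variables (R : realType) (d : measure_display) (T : measurableType d)
  (P : probability T R).
Implicit Types f g : T -> R.

Lemma bounded_measurable_cst (c : R) : bounded_measurable (fun _ : T => c).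
Proof. by split; [exact: measurable_cst|exists `|c|]. Qed.

Lemma bounded_measurableD f g : bounded_measurable f -> bounded_measurable g ->
  bounded_measurable (fun x => f x + g x).
Proof.
move=> [mf [M hM]] [mg [N hN]]; split; first exact: measurable_funD.
by exists (M + N) => x; rewrite (le_trans (ler_normD _ _))// lerD.
Qed.

Lemma bounded_measurableM f g : bounded_measurable f -> bounded_measurable g ->
  bounded_measurable (fun x => f x * g x).
Proof.
move=> [mf [M hM]] [mg [N hN]]; split; first exact: measurable_funM.
by exists (M * N) => x; rewrite normrM ler_pM.
Qed.

Lemma bounded_measurable_sum (I : Type) (r : seq I) (F : I -> T -> R) :
  (forall i, bounded_measurable (F i)) ->
  bounded_measurable (fun x => \sum_(i <- r) F i x).
Proof.
move=> bF; elim: r => [|i r ih].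
  under eq_fun do rewrite big_nil; exact: bounded_measurable_cst.
under eq_fun do rewrite big_cons; exact: bounded_measurableD.
Qed.

Lemma bounded_measurable_prod (I : Type) (r : seq I) (F : I -> T -> R) :
  (forall i, bounded_measurable (F i)) ->
  bounded_measurable (fun x => \prod_(i <- r) F i x).
Proof.
move=> bF; elim: r => [|i r ih].
  under eq_fun do rewrite big_nil; exact: bounded_measurable_cst.
under eq_fun do rewrite big_cons; exact: bounded_measurableM.
Qed.

Lemma bounded_measurable_expR f :
  bounded_measurable f -> bounded_measurable (fun x => expR (f x)).
Proof.
move=> [mf [M hM]]; split; first exact: measurableT_comp.
by exists (expR M) => x; rewrite ger0_norm ?expR_ge0// ler_expR (le_trans (ler_norm _)).
Qed.

(** The reason for singling out this class: integrability is automatic under a probability measure,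
    so linearity and monotonicity of the integral only require the closure properties above. *)
Lemma bounded_measurable_integrable f :
  bounded_measurable f -> P.-integrable setT (EFin \o f).
Proof.
move=> [mf [M hM]]; apply: measurable_bounded_integrable => //.
  exact: le_lt_trans (probability_le1 P measurableT) (ltry _).
exists M; split; first exact: num_real.
by move=> N MN x _; exact: le_trans (hM x) (ltW MN).
Qed.

Lemma Rintegral_cst_probability (c : R) : \int[P]_x c = c.
Proof. by rewrite Rintegral_cst// (_ : _ setT = 1%E) ?mulr1//; exact: probability_setT. Qed.

Lemma bounded_measurable_RintegralD f g :
  bounded_measurable f -> bounded_measurable g ->
  \int[P]_x (f x + g x) = \int[P]_x f x + \int[P]_x g x.
Proof. by move=> bf bg; apply: RintegralD => //; exact: bounded_measurable_integrable. Qed.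

Lemma bounded_measurable_RintegralZ (c : R) f : bounded_measurable f ->
  \int[P]_x (c * f x) = c * \int[P]_x f x.
Proof. by move=> bf; apply: RintegralZl => //; exact: bounded_measurable_integrable. Qed.

Lemma bounded_measurable_Rintegral_sum (I : Type) (r : seq I) (F : I -> T -> R) :
  (forall i, bounded_measurable (F i)) ->
  \int[P]_x (\sum_(i <- r) F i x) = \sum_(i <- r) \int[P]_x F i x.
Proof.
move=> bF; elim: r => [|i r ih].
  by under eq_Rintegral do rewrite big_nil; rewrite Rintegral_cst_probability big_nil.
under eq_Rintegral do rewrite big_cons.
rewrite bounded_measurable_RintegralD ?ih ?big_cons//.
exact: bounded_measurable_sum.
Qed.

Lemma bounded_measurable_le_Rintegral f g :
  bounded_measurable f -> bounded_measurable g -> (forall x, f x <= g x) ->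
  \int[P]_x f x <= \int[P]_x g x.
Proof.
by move=> bf bg fg; apply: le_Rintegral => //; exact: bounded_measurable_integrable.
Qed.

(** Markov's inequality in the form used by the Chernoff method: [f] dominates the indicator of [A].
    It is applied below to exponentials. *)
Lemma probability_le_Rintegral (A : set T) f : measurable A ->
  bounded_measurable f -> (forall x, 0 <= f x) -> (forall x, A x -> 1 <= f x) ->
  (P A <= (\int[P]_x f x)%:E)%E.
Proof.
move=> mA bf f0 Af.
rewrite /Rintegral fineK; last exact/integrable_fin_num/bounded_measurable_integrable.
rewrite -[P A]/(P A) -[A in P A]setIT -integral_indic//.
apply: ge0_le_integral => //.
- by apply/measurable_EFinP; exact: measurable_indic.
- by apply/measurable_EFinP; case: bf.
- move=> x _; rewrite lee_fin indicE; have [xA|_] := boolP (x \in A); last exact: f0.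
  by apply: Af; exact/set_mem.
Qed.

End bounded_measurable.
(** Giving the constant factor 1 to each index outside [r] turns the product over [r] into one over
    all of [I]; boundedness supplies the finiteness of the integrals. *)
Lemma Rintegral_prod_independent (R : realType) d (T : measurableType d)
    (P : probability T R) dE (E : measurableType dE) (I : finType)
    (X : I -> {RV P >-> E}) (g : I -> E -> R) (r : seq I) :
    mutually_independent X -> uniq r ->
    (forall i, bounded_measurable (g i)) -> (forall i e, 0 <= g i e) ->
  \int[P]_w (\prod_(i <- r) g i (X i w)) = \prod_(i <- r) \int[P]_w g i (X i w).
Proof.
move=> indX ur bg g0.
pose g' i := if i \in r then g i else fun=> 1.
have bg' i : bounded_measurable (g' i).
  by rewrite /g'; case: ifP => // _; exact: bounded_measurable_cst.
have bgX i : bounded_measurable (fun w => g' i (X i w)).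
  have [mg [M hM]] := bg' i; split; first exact: measurableT_comp.
  by exists M.
have prodE (V : I -> R) : \prod_(i <- r) V i = \prod_i (if i \in r then V i else 1).
  by rewrite -big_mkcond -big_uniq.
have fin i : (\int[P]_w (g' i (X i w))%:E \is a fin_num)%E.
  exact/integrable_fin_num/bounded_measurable_integrable.
have := independent_integral_prod (g := g') indX.
have -> : (\prod_i \int[P]_w (g' i (X i w))%:E)%E =
    (\prod_i \int[P]_w g' i (X i w))%:E.
  by rewrite -prodEFin; apply: eq_bigr => i _; rewrite /Rintegral fineK.
move=> h; rewrite prodE; transitivity (\prod_i \int[P]_w g' i (X i w)); last first.
  by apply: eq_bigr => i _; rewrite /g'; case: ifP => // _; rewrite Rintegral_cst_probability.
transitivity (\int[P]_w \prod_i g' i (X i w)).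
  by apply: eq_Rintegral => w _; rewrite prodE; apply: eq_bigr => i _; rewrite /g'; case: ifP.
rewrite /Rintegral h//.
- by move=> i; case: (bg' i).
- by move=> i e; rewrite /g'; case: ifP.
- by move=> i; rewrite ltey_eq fin.
Qed.

(** * The sample variance as an average over permutations *)

Fixpoint adjacent_pairs (A : Type) (s : seq A) : seq (A * A) :=
  if s is x :: y :: s' then (x, y) :: adjacent_pairs s' else [::].

Lemma seq_ind2step (A : Type) (Q : seq A -> Prop) :
  Q [::] -> (forall x, Q [:: x]) -> (forall x y s, Q s -> Q (x :: y :: s)) ->
  forall s, Q s.
Proof.
move=> h0 h1 h2 s; suff : Q s /\ forall x, Q (x :: s) by case.
by elim: s => [|x s [ih1 ih2]]; split=> // y; exact: h2.
Qed.

Lemma size_adjacent_pairs (A : Type) (s : seq A) :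
  size (adjacent_pairs s) = (size s)./2.
Proof. by elim/seq_ind2step: s => //= x y s ->. Qed.

Lemma map_adjacent_pairs (A B : Type) (f : A -> B) (s : seq A) :
  adjacent_pairs (map f s) = [seq (f q.1, f q.2) | q <- adjacent_pairs s].
Proof. by elim/seq_ind2step: s => //= x y s ->. Qed.

(** This encodes the disjointness of the pairs: if [s] is duplicate-free, so is the flattened list,
    and distinct pairs then involve independent variables. *)
Lemma subseq_adjacent_pairs (A : eqType) (s : seq A) :
  subseq (flatten [seq [:: q.1; q.2] | q <- adjacent_pairs s]) s.
Proof. by elim/seq_ind2step: s => //= x y s ih; rewrite !eqxx. Qed.

Lemma adjacent_pairs_neq (A : eqType) (s : seq A) (q : A * A) :
  uniq s -> q \in adjacent_pairs s -> q.1 != q.2.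
Proof.
elim/seq_ind2step: s => //= x y s ih /and3P[xs _ us].
rewrite inE => /predU1P[->/=|]; last exact: ih.
by move: xs; rewrite inE; case: eqP.
Qed.

(** The symmetric group is doubly transitive, so the sum over permutations is the same for each of
    the [m (m - 1)] ordered pairs of distinct indices. Add these sums up and exchange the order:
    each permutation merely reorders the ordered pairs. *)
Lemma sum_perm_pair (R : realType) (m : nat) (F : 'I_m -> 'I_m -> R) (a b : 'I_m) :
  a != b ->
  (m%:R * (m%:R - 1)) * \sum_(s : {perm 'I_m}) F (s a) (s b) =
  #|{perm 'I_m}|%:R * \sum_i \sum_(j | i != j) F i j.
Proof.
move=> ab.
have const (i j : 'I_m) : i != j -> \sum_(s : {perm 'I_m}) F (s i) (s j) =
    \sum_(s : {perm 'I_m}) F (s a) (s b).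
  move=> ij; have [tau ti tj] : exists2 tau : {perm 'I_m}, tau i = a & tau j = b.
    (* [tperm i a] sends [i] to [a] and [j] to [c]; as [c] and [b] both differ from [a], the
       transposition of [c] and [b] then corrects the image of [j] without moving [a]. *)
    pose c := tperm i a j.
    have ca : c != a.
      by rewrite /c -[X in _ != X](tpermL i a) (inj_eq perm_inj) eq_sym.
    exists (tperm i a * tperm c b)%g; last by rewrite permM -/c tpermL.
    by rewrite permM tpermL tpermD// eq_sym.
  rewrite [LHS](reindex_inj (mulgI tau)) /=; apply: eq_bigr => s _.
  by rewrite !permM ti tj.
transitivity (\sum_i \sum_(j | i != j) \sum_(s : {perm 'I_m}) F (s i) (s j)).
  set C := \sum_(s : {perm 'I_m}) F (s a) (s b).
  transitivity (\sum_(i < m) \sum_(j < m | i != j) C); last first.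
    by apply: eq_bigr => i _; apply: eq_bigr => j ij; exact/esym/const.
  transitivity (\sum_(i < m) m.-1%:R * C).
    rewrite sumr_const card_ord -[RHS]mulr_natl [RHS]mulrA; congr (_ * _ * _).
    by rewrite -subn1 natrB//; apply: leq_ltn_trans (ltn_ord a).
  apply: eq_bigr => i _; rewrite sumr_const mulr_natl; congr (_ *+ _).
  rewrite -[m in LHS]card_ord -(cardC1 i); apply: eq_card => j.
  by rewrite !inE eq_sym.
transitivity (\sum_i \sum_(s : {perm 'I_m}) \sum_(j | i != j) F (s i) (s j)).
  by apply: eq_bigr => i _; rewrite exchange_big.
rewrite exchange_big /=.
rewrite mulr_natl -sumr_const; apply: eq_bigr => s _.
rewrite [RHS](reindex_inj (@perm_inj _ s)); apply: eq_bigr => i _.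
rewrite [RHS](reindex_inj (@perm_inj _ s)); apply: eq_bigl => j.
by rewrite (inj_eq perm_inj).
Qed.

(** A single pair, averaged over all permutations, already yields the sample variance. Taking the
    mean over [m./2] disjoint pairs does not change the value, but makes the inner expression a mean
    of independent terms when the [z i] are independent. *)
Lemma sample_variance_perm (R : realType) (m : nat) (z : 'I_m -> R) : (1 < m)%N ->
  sample_variance z = #|{perm 'I_m}|%:R^-1 * \sum_(s : {perm 'I_m})
    (m./2%:R^-1 * \sum_(q <- adjacent_pairs (enum 'I_m))
       (z (s q.1) - z (s q.2)) ^+ 2 / 2).
Proof.
move=> m1.
have mm0 : (m%:R * (m%:R - 1) : R) != 0.
  by rewrite mulf_neq0 ?subr_eq0 ?pnatr_eq1 ?pnatr_eq0; lia.
have N0 : (#|{perm 'I_m}|%:R : R) != 0.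
  by rewrite pnatr_eq0 -lt0n; apply/card_gt0P; exists 1%g.
have k0 : (m./2%:R : R) != 0 by rewrite pnatr_eq0; lia.
pose F i j : R := (z i - z j) ^+ 2.
have sumE : \sum_i \sum_(j | i != j) F i j =
    2 * \sum_(i < m) \sum_(j < m | (i < j)%N) F i j.
  transitivity (\sum_(i < m) (\sum_(j < m | (i < j)%N) F i j + \sum_(j < m | (j < i)%N) F i j)).
    apply: eq_bigr => i _; rewrite [LHS](bigID (fun j : 'I_m => (i < j)%N)) /=.
    by congr (_ + _); apply: eq_bigl => j; rewrite -(inj_eq val_inj) /=; case: ltngtP.
  rewrite big_split /= [X in _ + X](exchange_big_dep xpredT) //=.
  rewrite mulr_natl mulr2n; congr (_ + _); apply: eq_bigr => i _; apply: eq_bigr => j _.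
  by rewrite /F -sqrrN opprB.
rewrite -mulr_sumr exchange_big /= big_seq.
have hq q : q \in adjacent_pairs (enum 'I_m) ->
    \sum_(s : {perm 'I_m}) (z (s q.1) - z (s q.2)) ^+ 2 / 2 =
    #|{perm 'I_m}|%:R * sample_variance z.
  move=> /(adjacent_pairs_neq (enum_uniq _)) q12.
  rewrite -mulr_suml; apply: (mulfI mm0).
  rewrite mulrA (sum_perm_pair F q12) sumE /sample_variance -/F.
  by field; rewrite andbC -negb_or -mulf_eq0.
rewrite (eq_bigr _ hq) -big_seq big_const_seq count_predT size_adjacent_pairs.
rewrite size_enum_ord iter_addr_0 -mulr_natl; field.
by rewrite k0.
Qed.

(** * Bernstein and empirical Bernstein inequalities for values in [[0, 1]] *)

Section concentration.
Variables (R : realType) (d : measure_display) (T : measurableType d)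
  (P : probability T R) (dE : measure_display) (E : measurableType dE)
  (m : nat) (X : 'I_m -> {RV P >-> E}) (h : E -> R) (mu m2 : R).
Hypothesis m1 : (1 < m)%N.
Hypothesis indX : mutually_independent X.
Hypothesis mh : measurable_fun setT h.
Hypothesis h01 : forall e, 0 <= h e <= 1.
Hypothesis meanh : forall i, \int[P]_w h (X i w) = mu.
Hypothesis meanh2 : forall i, \int[P]_w h (X i w) ^+ 2 = m2.

Let Y i w := h (X i w).
Let s2 := m2 - mu ^+ 2.
Let V w := sample_variance (fun i => Y i w).

Let bh : bounded_measurable h.
Proof. by split=> //; exists 1 => e; have /andP[h0 h1] := h01 e; rewrite ger0_norm. Qed.

Let bY i : bounded_measurable (Y i).
Proof. by split; [exact: measurableT_comp|exists 1 => w; rewrite /Y ger0_norm; case/andP: (h01 (X i w))]. Qed.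

Let bcst (c : R) : bounded_measurable (fun _ : T => c).
Proof. exact: bounded_measurable_cst. Qed.

Let measurable_le (f g : T -> R) : measurable_fun setT f -> measurable_fun setT g ->
  measurable [set w | f w <= g w].
Proof. by move=> mf mg; rewrite -[[set w | _]]setTI; exact: measurable_fun_le. Qed.

Let Rintegral_quadratic i (a b c : R) :
  \int[P]_w (a + b * Y i w + c * (Y i w * Y i w)) = a + b * mu + c * m2.
Proof.
have b1 : bounded_measurable (fun w => b * Y i w) by exact: bounded_measurableM.
have b2 : bounded_measurable (fun w => Y i w * Y i w) by exact: bounded_measurableM.
rewrite bounded_measurable_RintegralD//; last 2 first.
- exact: bounded_measurableD.
- exact: bounded_measurableM.
rewrite bounded_measurable_RintegralD// Rintegral_cst_probability.
rewrite !bounded_measurable_RintegralZ// meanh -(meanh2 i).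
by congr (_ + _ * _); apply: eq_Rintegral => w _; rewrite expr2.
Qed.

Let mu01 : 0 <= mu <= 1.
Proof.
have i0 : 'I_m by exact: Ordinal m1.
rewrite -(meanh i0) Rintegral_ge0 => [/=|w _]; last by case/andP : (h01 (X i0 w)).
rewrite -[leRHS](Rintegral_cst_probability P); apply: bounded_measurable_le_Rintegral => //.
  exact: bY.
by move=> w; case/andP : (h01 (X i0 w)).
Qed.

Let s2_le1 : s2 <= 1.
Proof.
have i0 : 'I_m by exact: Ordinal m1.
have : m2 <= 1; last by have := sqr_ge0 mu; rewrite /s2; lra.
rewrite -(meanh2 i0) -[leRHS](Rintegral_cst_probability P).
apply: bounded_measurable_le_Rintegral => //.
  by under eq_fun do rewrite expr2; apply: bounded_measurableM; exact: (bY i0).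
by move=> w; have /andP[h0 h1] := h01 (X i0 w); exact: exprn_ile1.
Qed.

Let s2_ge0 : 0 <= s2.
Proof.
have i0 : 'I_m by exact: Ordinal m1.
(* The integrand is [(Y i0 w - mu) ^+ 2], expanded. *)
have -> : s2 = \int[P]_w (mu ^+ 2 + (- 2 * mu) * Y i0 w + 1 * (Y i0 w * Y i0 w)).
  by rewrite Rintegral_quadratic /s2; ring.
apply: Rintegral_ge0 => w _; have := sqr_ge0 (Y i0 w - mu); lra.
Qed.

(** Independence factors the moment generating function. By [expRM_le_quadratic] at [Y i w - mu],
    whose mean is 0, each factor is at most [1 + s2 * phi], hence at most [expR (s2 * phi)]. *)
Let Rintegral_exp_centered_sum (th : R) : 0 <= th ->
  \int[P]_w expR (th * \sum_i (Y i w - mu)) <= expR (m%:R * (s2 * (expR th - 1 - th))).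
Proof.
move=> th0.
pose g (i : 'I_m) e := expR (th * (h e - mu)).
have bg i : bounded_measurable (g i).
  apply: bounded_measurable_expR; apply: bounded_measurableM.
    exact: bounded_measurable_cst.
  by apply: bounded_measurableD => //; exact: bounded_measurable_cst.
apply: (@le_trans _ _ (\prod_i \int[P]_w g i (X i w))).
  rewrite -(Rintegral_prod_independent indX (index_enum_uniq _) bg); last first.
    by move=> i e; exact: expR_ge0.
  by rewrite le_eqVlt; apply/orP; left; apply/eqP/eq_Rintegral => w _; rewrite mulr_sumr expR_sum.
rewrite expRM_natl -[m in leRHS]card_ord -prodr_const.
apply: ler_prod => i _; rewrite Rintegral_ge0 => [/=|w _]; last exact: expR_ge0.
pose phi := expR th - 1 - th.
apply: (@le_trans _ _ (1 + s2 * phi)); last exact: expR_ge1Dx.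
(* The middle term is [1 + th (Y - mu) + phi (Y - mu)^2], sorted by powers of [Y]. *)
apply: (@le_trans _ _ (\int[P]_w ((1 - th * mu + phi * mu ^+ 2) +
    (th - 2 * phi * mu) * Y i w + phi * (Y i w * Y i w)))); last first.
  by rewrite Rintegral_quadratic /s2; rewrite le_eqVlt; apply/orP; left; apply/eqP; ring.
apply: bounded_measurable_le_Rintegral.
- have [mg [M hM]] := bg i; split; first exact: measurableT_comp.
  by exists M.
- apply: bounded_measurableD; last by do 2! apply: bounded_measurableM => //.
  by apply: bounded_measurableD => //; exact: bounded_measurableM.
- move=> w; rewrite /g -/(Y i w).
  have Ymu : `|Y i w - mu| <= 1.
    rewrite ler_norml; have := h01 (X i w); rewrite -/(Y i w).
    by move: mu01 => /andP[? ?] /andP[? ?]; apply/andP; split; lra.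
  by apply: (le_trans (expRM_le_quadratic th0 Ymu)); rewrite -/phi; rewrite le_eqVlt; apply/orP; left; apply/eqP; ring.
Qed.

Let bsq i j : bounded_measurable (fun w => (Y i w - Y j w) ^+ 2 / 2).
Proof.
have bij : bounded_measurable (fun w => Y i w - Y j w).
  apply: bounded_measurableD => //; under eq_fun do rewrite -mulN1r.
  exact: bounded_measurableM.
apply: bounded_measurableM => //; under eq_fun do rewrite expr2.
exact: bounded_measurableM.
Qed.

(* Each factor is a combination of four products [u (X a) * v (X b)], which are
   absorbed into the second product. *)
Let Rintegral_pairs (ka : R) (l : seq ('I_m * 'I_m)) :
  forall (r : seq 'I_m) (g : 'I_m -> E -> R),
    uniq (flatten [seq [:: q.1; q.2] | q <- l] ++ r) ->
    (forall i, bounded_measurable (g i)) -> (forall i e, 0 <= g i e) ->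
  \int[P]_w (\prod_(q <- l) (1 - ka * ((Y q.1 w - Y q.2 w) ^+ 2 / 2)) *
             \prod_(i <- r) g i (X i w)) =
  (1 - ka * s2) ^+ size l * \prod_(i <- r) \int[P]_w g i (X i w).
Proof.
elim: l => [|[a b] l ih] r g /=.
  move=> ur bg g0; under eq_Rintegral do rewrite big_nil mul1r.
  by rewrite expr0 mul1r Rintegral_prod_independent.
move=> /and3P[]; rewrite inE !mem_cat !negb_or => /and3P[ab al ar] /andP[bl br] ur bg g0.
pose G (u v : E -> R) i := if i == a then u else if i == b then v else g i.
pose J (u v : E -> R) w := \prod_(q <- l) (1 - ka * ((Y q.1 w - Y q.2 w) ^+ 2 / 2)) *
   \prod_(i <- a :: b :: r) G u v i (X i w).
(* The induction hypothesis asks for nonnegative factors, so the signs arising in the expansion stay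
   outside [J] as coefficients. *)
pose adm (u : E -> R) := bounded_measurable u /\ forall e, 0 <= u e.
have adm1 : adm (fun=> 1) by split=> //; exact: bounded_measurable_cst.
have admh : adm h by split=> // e; case/andP : (h01 e).
have admh2 : adm (fun e => h e ^+ 2).
  split=> [|e]; last exact: sqr_ge0.
  under eq_fun do rewrite expr2; exact: bounded_measurableM.
have bG u v i : adm u -> adm v -> bounded_measurable (G u v i).
  by move=> [bu _] [bv _]; rewrite /G; do 2! case: ifP => // _.
have Gr u v (H : 'I_m -> (E -> R) -> R) :
    \prod_(i <- a :: b :: r) H i (G u v i) = H a u * (H b v * \prod_(i <- r) H i (g i)).
  rewrite !big_cons /G !eqxx eq_sym (negbTE ab); congr (_ * (_ * _)).
  rewrite !big_seq; apply: eq_bigr => i ir.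
  by do 2! (case: eqP => [ia|_]; first by move: ar br; rewrite -ia ir).
have bJ u v : adm u -> adm v -> bounded_measurable (J u v).
  move=> hu hv; apply: bounded_measurableM; apply: bounded_measurable_prod => i.
    apply: bounded_measurableD => //.
    under eq_fun do rewrite -mulNr; exact: bounded_measurableM.
  have [mG [M hM]] := bG u v i hu hv; split; first exact: measurableT_comp.
  by exists M.
have intJ u v : adm u -> adm v -> \int[P]_w J u v w = (1 - ka * s2) ^+ size l *
    (\int[P]_w u (X a w) * (\int[P]_w v (X b w) * \prod_(i <- r) \int[P]_w g i (X i w))).
  move=> hu hv; rewrite ih.
  - by rewrite (Gr u v (fun i f => \int[P]_w f (X i w))).
  - rewrite (uniq_catCA _ [:: a; b]) /= inE !mem_cat !negb_or ab al ar bl br.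
    exact: ur.
  - by move=> i; exact: bG.
  - by move=> i e; rewrite /G; case: hu => _ hu; case: hv => _ hv; do 2! case: ifP => // _.
(* Expansion of [1 - ka (Y a - Y b)^2 / 2]. After integration the four coefficients combine to
   [1 - ka m2 + ka mu^2 = 1 - ka s2]. *)
transitivity (\int[P]_w (J (fun=> 1%R) (fun=> 1%R) w + ((- ka / 2) * J (fun e => h e ^+ 2) (fun=> 1%R) w +
   ((- ka / 2) * J (fun=> 1%R) (fun e => h e ^+ 2) w + ka * J h h w)))).
  apply: eq_Rintegral => w _; rewrite big_cons /J.
  rewrite !(Gr _ _ (fun i f => f (X i w))) /= -/(Y a w) -/(Y b w).
  by field.
have bcJ c u v : adm u -> adm v -> bounded_measurable (fun w => c * J u v w).
  by move=> hu hv; apply: bounded_measurableM => //; exact: bJ.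
rewrite bounded_measurable_RintegralD; first last.
- by do 2! [apply: bounded_measurableD; first exact: bcJ]; exact: bcJ.
- exact: bJ.
rewrite bounded_measurable_RintegralD; first last.
- by apply: bounded_measurableD; exact: bcJ.
- exact: bcJ.
rewrite bounded_measurable_RintegralD; try exact: bcJ.
rewrite !bounded_measurable_RintegralZ; try exact: bJ.
rewrite !intJ// !Rintegral_cst_probability !meanh !meanh2 exprS /s2.
by field.
Qed.

Let V_ge0 w : 0 <= V w.
Proof.
apply: mulr_ge0; last by do 2! apply: sumr_ge0 => ? _; exact: sqr_ge0.
by rewrite invr_ge0 mulr_ge0// subr_ge0 ler1n ltnW.
Qed.

Let bsum : bounded_measurable (fun w => \sum_i (Y i w - mu)).
Proof. by apply: bounded_measurable_sum => i; exact: bounded_measurableD. Qed.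

Let bV : bounded_measurable V.
Proof.
rewrite /V /sample_variance; apply: bounded_measurableM => //.
apply: bounded_measurable_sum => i; under eq_fun do rewrite -big_filter.
apply: bounded_measurable_sum => j; under eq_fun do rewrite expr2.
have bij : bounded_measurable (fun w => Y i w - Y j w).
  apply: bounded_measurableD => //; under eq_fun do rewrite -mulN1r.
  exact: bounded_measurableM.
exact: bounded_measurableM.
Qed.

Let mV : measurable_fun setT V.
Proof. by case: bV. Qed.

Let mmean : measurable_fun setT (fun w => sample_mean (fun i => Y i w)).
Proof.
suff [] : bounded_measurable (fun w => sample_mean (fun i => Y i w)) by [].
apply: bounded_measurableM => //; exact: bounded_measurable_sum.
Qed.

Let measurable_mean_ge (c : R) :
  measurable [set w | (c <= sample_mean (fun i => Y i w))%R].
Proof. exact: measurable_le. Qed.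

Let measurable_V_lt (c : R) : measurable [set w | (V w < c)%R].
Proof.
rewrite (_ : [set w | _] = ~` [set w | c <= V w]); first exact/measurableC/measurable_le.
by apply/seteqP; split=> w /=; rewrite ltNge => /negP.
Qed.

(** With [k = m./2] and [c = th / k], convexity moves the exponential inside the average over
    permutations. Each permutation gives a product over disjoint pairs of [expR (- (c * W))],
    replaced by an affine function of [W] so that [Rintegral_pairs] computes the integral
    exactly. *)
Let Rintegral_exp_sample_variance (th : R) : 0 <= th ->
  \int[P]_w expR (- (th * V w)) <=
  expR (- (m./2%:R * (th / m./2%:R - (th / m./2%:R) ^+ 2 / 4) * s2)).
Proof.
move=> th0; set k := m./2; set c := th / k%:R; pose ka := c - c ^+ 2 / 4.
have k0 : (0 < k)%N by rewrite /k; lia.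
have c0 : 0 <= c by rewrite divr_ge0.
set l := adjacent_pairs (enum 'I_m).
have sl : size l = k by rewrite size_adjacent_pairs size_enum_ord.
pose Z (s : {perm 'I_m}) w :=
  \prod_(q <- l) (1 - ka * ((Y (s q.1) w - Y (s q.2) w) ^+ 2 / 2)).
have bZ s : bounded_measurable (Z s).
  apply: bounded_measurable_prod => q; apply: bounded_measurableD => //.
  by under eq_fun do rewrite -mulNr; exact: bounded_measurableM.
have N0 : (0 < #|{perm 'I_m}|)%N by apply/card_gt0P; exists 1%g.
have step w (i j : 'I_m) : expR (- (c * ((Y i w - Y j w) ^+ 2 / 2))) <=
    1 - ka * ((Y i w - Y j w) ^+ 2 / 2).
  set W := _ / 2.
  have W01 : 0 <= W <= 1 / 2.
    (* The bound [W <= 1/2] yields [W^2 <= W / 2], which makes the quadratic bound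
       [1 - c W + c^2 W^2 / 2] at most [1 - ka W]. *)
    have /andP[yi0 yi1] := h01 (X i w); have /andP[yj0 yj1] := h01 (X j w).
    by rewrite /W divr_ge0 ?sqr_ge0//= ler_wpM2r// /Y; nra.
  have /andP[W0 W1] := W01.
  apply: (le_trans (expRN_le_quadratic (mulr_ge0 c0 W0))).
  have : 0 <= c ^+ 2 * (W * (1 / 2 - W)) by rewrite mulr_ge0 ?sqr_ge0// mulr_ge0// subr_ge0.
  rewrite /ka; lra.
have pointwise w : expR (- (th * V w)) <= #|{perm 'I_m}|%:R^-1 * \sum_s Z s w.
  rewrite /V (sample_variance_perm _ m1) -/l.
  have -> : - (th * (#|{perm 'I_m}|%:R^-1 * \sum_(s : {perm 'I_m}) (k%:R^-1 *
      \sum_(q <- l) (Y (s q.1) w - Y (s q.2) w) ^+ 2 / 2))) =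
      #|{perm 'I_m}|%:R^-1 * \sum_(s : {perm 'I_m})
        \sum_(q <- l) - (c * ((Y (s q.1) w - Y (s q.2) w) ^+ 2 / 2)).
    rewrite mulrCA -mulrN; congr (_ * _); rewrite mulr_sumr -sumrN.
    apply: eq_bigr => s _; rewrite mulrA -/c mulr_sumr -sumrN.
    by apply: eq_bigr => q _.
  apply: (le_trans (expR_mean_le _ N0)); rewrite ler_wpM2l//.
  apply: ler_sum => s _; rewrite expR_sum; apply: ler_prod => q _.
  by rewrite expR_ge0 step.
apply: (@le_trans _ _ (\int[P]_w (#|{perm 'I_m}|%:R^-1 * \sum_s Z s w))).
  apply: bounded_measurable_le_Rintegral => //.
    by apply: bounded_measurable_expR; under eq_fun do rewrite -mulNr; exact: bounded_measurableM.
  by apply: bounded_measurableM => //; exact: bounded_measurable_sum.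
rewrite bounded_measurable_RintegralZ; last exact: bounded_measurable_sum.
rewrite bounded_measurable_Rintegral_sum//.
have intZ s : \int[P]_w Z s w = (1 - ka * s2) ^+ k.
  (* [Z s] is the product over the adjacent pairs of the permuted enumeration, which are again
     disjoint. *)
  have us : uniq (flatten [seq [:: q.1; q.2] | q <- adjacent_pairs (map s (enum 'I_m))] ++ [::]).
    rewrite cats0; apply: (subseq_uniq (subseq_adjacent_pairs _)).
    by rewrite map_inj_uniq ?enum_uniq//; exact: perm_inj.
  have b1 (i : 'I_m) : bounded_measurable (fun _ : E => 1 : R).
    exact: bounded_measurable_cst.
  have := Rintegral_pairs ka us b1 (fun _ _ => ler01).
  rewrite [X in _ = _ * X]big_nil mulr1 map_adjacent_pairs size_map -/l sl => <-.
  by apply: eq_Rintegral => w _; rewrite big_nil mulr1 big_map.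
under eq_bigr do rewrite intZ.
rewrite sumr_const -[X in _ * X]mulr_natl mulrA mulVf ?pnatr_eq0 -?lt0n// mul1r.
(* The base must be nonnegative before [1 - x <= expR (- x)] is raised to the power [k]; this rests
   on [s2 <= 1] and [1 - ka = (c / 2 - 1)^2]. *)
have ka1 : 0 <= 1 - ka * s2.
  rewrite (_ : _ - _ = (1 - s2) + s2 * (c / 2 - 1) ^+ 2); last by rewrite /ka; field.
  by rewrite addr_ge0 ?subr_ge0// mulr_ge0 ?sqr_ge0.
rewrite [X in _ <= expR X](_ : _ = k%:R * - (ka * s2)); last by rewrite /ka; ring.
rewrite expRM_natl; apply: lerXn2r; rewrite ?nnegrE ?expR_ge0//.
by have := expR_ge1Dx (- (ka * s2)).
Qed.

(** Chernoff's method: the moment generating function is bounded by [Rintegral_exp_centered_sum],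
    and it remains to find a [th] making the total exponent at most [- L]. *)
Lemma bernstein_upper_tail (L : R) : 0 < L ->
  (P [set w | (mu + Num.sqrt (2 * s2 * L / m%:R) + L / (3 * m%:R) <=
              sample_mean (fun i => Y i w))%R] <= (expR (- L))%:E)%E.
Proof.
move=> L0; pose u := Num.sqrt (2 * s2 * L / m%:R) + L / (3 * m%:R).
have M0 : 0 < m%:R :> R by rewrite ltr0n ltnW.
have [th th0 hth] : exists2 th : R, 0 <= th &
    m%:R * (s2 * (expR th - 1 - th)) - th * (m%:R * u) <= - L.
  (* Degenerate case: the limit of [y / (1 + y / 3)] below as [s2] tends to 0. *)
  have [s20|s2n0] := eqVneq s2 0.
    exists 3 => //; rewrite s20 /u s20 !(mul0r, mulr0) sqrtr0 add0r.
    rewrite le_eqVlt; apply/orP; left; apply/eqP; field; lra.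
  have sp : 0 < s2 by rewrite lt_neqAle eq_sym s2n0.
  set y := Num.sqrt (2 * L / (m%:R * s2)).
  have y0 : 0 <= y by exact: sqrtr_ge0.
  have y2 : y ^+ 2 = 2 * L / (m%:R * s2).
    by rewrite sqr_sqrtr// divr_ge0 ?mulr_ge0// ltW.
  have msy : m%:R * (s2 * y ^+ 2) = 2 * L by rewrite y2; field; rewrite !gt_eqF.
  have sy : Num.sqrt (2 * s2 * L / m%:R) = s2 * y.
    rewrite -[RHS]ger0_norm ?mulr_ge0// -sqrtr_sqr; congr Num.sqrt.
    by rewrite exprMn y2; field; rewrite !gt_eqF.
  pose D := 1 + y / 3; have D0 : 0 < D by rewrite /D; lra.
  (* This solves [th / (1 - th / 3) = y] and minimises [m s2 th^2 / (2 (1 - th / 3)) - th m u]. The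
     minimum is [L / D - (2 L + y L / 3) / D], which is exactly [- L]. *)
  exists (y / D); first by rewrite divr_ge0// ltW.
  have th3 : 0 <= y / D < 3.
    by rewrite divr_ge0 ?(ltW D0)//= ltr_pdivrMr// /D; lra.
  have tail := expR_tail_le th3; set th := y / D in tail *.
  have tailE : th ^+ 2 / (2 * (1 - th / 3)) = y ^+ 2 / (2 * D).
    have -> : 1 - th / 3 = D^-1.
      apply: (mulIf (lt0r_neq0 D0)); rewrite mulVf ?lt0r_neq0// mulrBl mul1r.
      by rewrite /th mulrAC divfK ?lt0r_neq0// /D; ring.
    by rewrite /th; field; rewrite gt_eqF.
  apply: (@le_trans _ _ (m%:R * (s2 * (y ^+ 2 / (2 * D))) - th * (m%:R * u))).
    by rewrite lerD2r ler_wpM2l// ler_wpM2l// -tailE.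
  have -> : m%:R * (s2 * (y ^+ 2 / (2 * D))) = L / D.
    by rewrite [_ * (_ / _)]mulrA mulrA msy; field; rewrite gt_eqF.
  have -> : th * (m%:R * u) = (2 * L + y * L / 3) / D.
    rewrite /u sy -msy /th; field.
    by rewrite !gt_eqF.
  rewrite le_eqVlt; apply/orP; left; apply/eqP.
  by rewrite /D; field; rewrite gt_eqF//; lra.
pose F w := expR (- (th * (m%:R * u))) * expR (th * \sum_i (Y i w - mu)).
have bF : bounded_measurable (fun w => expR (th * \sum_i (Y i w - mu))).
  by apply: bounded_measurable_expR; exact: bounded_measurableM.
apply: (@le_trans _ _ (\int[P]_w F w)%:E).
  apply: probability_le_Rintegral => //.
  - exact: bounded_measurableM.
  - by move=> w; rewrite mulr_ge0 ?expR_ge0.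
  - move=> w /=; rewrite -addrA -/u => hw; rewrite /F -expRD -[leLHS]expR0 ler_expR.
    rewrite [leRHS](_ : _ = th * (\sum_i (Y i w - mu) - m%:R * u)); last by ring.
    rewrite mulr_ge0// subr_ge0 sumrB sumr_const card_ord.
    have -> : \sum_i Y i w = m%:R * sample_mean (fun i => Y i w).
      by rewrite /sample_mean mulVKf// gt_eqF.
    by rewrite -[mu *+ m]mulr_natl -mulrBr ler_pM2l// lerBrDl.
rewrite lee_fin /F bounded_measurable_RintegralZ//.
apply: (@le_trans _ _ (expR (- (th * (m%:R * u))) *
    expR (m%:R * (s2 * (expR th - 1 - th))))).
  by rewrite ler_wpM2l ?expR_ge0//; exact: Rintegral_exp_centered_sum.
by rewrite -expRD ler_expR addrC.
Qed.

(** Chernoff's method for [- V]. The threshold [sd (sd - a)] has this product form because, off the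
    event, it can be solved for [sd <= sqrt V + a]. *)
Lemma sample_variance_lower_tail (L : R) : 0 < L ->
  (P [set w | (V w < Num.sqrt s2 * (Num.sqrt s2 - Num.sqrt (2 * L / (m%:R - 1))))%R]
   <= (expR (- L))%:E)%E.
Proof.
move=> L0; set a := Num.sqrt (2 * L / _); set sd := Num.sqrt s2.
have [s20|s2n0] := eqVneq s2 0.
  rewrite (_ : [set w | _] = set0) ?measure0 ?lee_fin ?expR_ge0//.
  by apply/seteqP; split=> w //=; rewrite /sd s20 sqrtr0 mul0r ltNge V_ge0.
have sp : 0 < s2 by rewrite lt_neqAle eq_sym s2n0.
have sd0 : 0 < sd by rewrite sqrtr_gt0.
have sd2 : sd ^+ 2 = s2 by rewrite sqr_sqrtr.
have M0 : 0 < m%:R - 1 :> R by rewrite subr_gt0 ltr1n.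
have a2 : a ^+ 2 = 2 * L / (m%:R - 1) by rewrite sqr_sqrtr// divr_ge0 ?mulr_ge0// ltW.
have a0 : 0 <= a by exact: sqrtr_ge0.
set k := m./2; have k0 : 0 < k%:R :> R.
  by rewrite ltr0n /k half_gt0.
(* For odd [m] one observation stays unpaired, hence [m - 1] in place of [m]. *)
have km : m%:R - 1 <= 2 * k%:R :> R.
  rewrite lerBlDr -natrM natr1 ler_nat mul2n -[leqLHS](odd_double_half m).
  by rewrite -add1n leq_add2r leq_b1.
(* Minimiser of the exponent [- th sd a + th^2 s2 / (4 k)]; its minimum is [- k a^2], and
   [k a^2 >= L] because [2 k >= m - 1]. *)
pose th := 2 * k%:R * a / sd.
have th0 : 0 <= th by rewrite divr_ge0 ?mulr_ge0// ltW.
pose F w := expR (th * (sd * (sd - a))) * expR (- (th * V w)).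
have bF : bounded_measurable (fun w => expR (- (th * V w))).
  by apply: bounded_measurable_expR; under eq_fun do rewrite -mulNr; exact: bounded_measurableM.
apply: (@le_trans _ _ (\int[P]_w F w)%:E).
  apply: probability_le_Rintegral => //.
  - exact: bounded_measurableM.
  - by move=> w; rewrite mulr_ge0 ?expR_ge0.
  - move=> w /= hw; rewrite /F -expRD -[leLHS]expR0 ler_expR.
    by rewrite -mulrBr mulr_ge0// subr_ge0 ltW.
rewrite lee_fin /F bounded_measurable_RintegralZ//.
apply: le_trans (ler_wpM2l (expR_ge0 _) (Rintegral_exp_sample_variance th0)) _.
rewrite -/k -expRD ler_expR.
have -> : th * (sd * (sd - a)) +
    - (k%:R * (th / k%:R - (th / k%:R) ^+ 2 / 4) * s2) = - (k%:R * a ^+ 2).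
  by rewrite -sd2 /th; field; rewrite !gt_eqF.
rewrite lerN2 a2 mulrA ler_pdivlMr//.
by rewrite (_ : _ * (2 * L) = L * (2 * k%:R)) ?ler_pM2l//; ring.
Qed.

(** Each tail event has probability at most [expR (- L) = alpha / 2]; off their union the inequality
    is deterministic. Any [c] above the mean is allowed because the clipped estimator is biased
    downwards. *)
Lemma empirical_bernstein (alpha c : R) : 0 < alpha < 1 -> mu <= c ->
  ((1 - alpha)%:E <= P [set w | (sample_mean (fun i => Y i w)
     - Num.sqrt (2 * V w * ln (2 / alpha) / m%:R)
     - 7 * ln (2 / alpha) / (3 * (m%:R - 1)) <= c)%R])%E.
Proof.
move=> /andP[al0 al1] muc; set L := ln (2 / alpha).
have L0 : 0 < L by rewrite ln_gt0// ltr_pdivlMr//; lra.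
have eL : expR (- L) = alpha / 2.
  by rewrite expRN /L lnK ?posrE ?divr_gt0// invf_div.
pose bad1 := [set w | (mu + Num.sqrt (2 * s2 * L / m%:R) + L / (3 * m%:R) <=
              sample_mean (fun i => Y i w))%R].
pose bad2 := [set w | (V w < Num.sqrt s2 * (Num.sqrt s2 - Num.sqrt (2 * L / (m%:R - 1))))%R].
have M0 : 0 < m%:R - 1 :> R by rewrite subr_gt0 ltr1n.
have mb1 : measurable bad1 by exact: measurable_mean_ge.
have mb2 : measurable bad2 by exact: measurable_V_lt.
set good := [set w | _].
have mgood : measurable good.
  apply: measurable_le => //; apply: measurable_funB => //.
  apply: measurable_funB => //.
  apply: (measurableT_comp (continuous_measurable_fun (@sqrt_continuous R))).
  by do 2! apply: measurable_funM => //; exact: measurable_funM.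
have Pbad : (P (bad1 `|` bad2) <= alpha%:E)%E.
  apply: (@le_trans _ _ (P bad1 + P bad2)%E); first exact: measureU2.
  rewrite [alpha]splitr EFinD -eL; apply: leeD.
    exact: bernstein_upper_tail.
  exact: sample_variance_lower_tail.
apply: (@le_trans _ _ (P (~` (bad1 `|` bad2)))).
  rewrite probability_setC; last exact: measurableU.
  rewrite EFinB; apply: leeB => //.
apply: le_measure; rewrite ?inE//; first by apply: measurableC; exact: measurableU.
rewrite setCU => w [/negP + /negP] /=; rewrite -leNgt -ltNge => hb1 hb2.
set sd := Num.sqrt s2 in hb2.
set a := Num.sqrt (2 * L / _) in hb2.
have a0 : 0 <= a by exact: sqrtr_ge0.
have a2 : a ^+ 2 = 2 * L / (m%:R - 1) by rewrite sqr_sqrtr// divr_ge0 ?mulr_ge0// ltW.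
have M0' : 0 < m%:R :> R by lra.
have sV0 : 0 <= Num.sqrt (V w) by exact: sqrtr_ge0.
have sdV : sd <= Num.sqrt (V w) + a.
  (* Otherwise [V = sqrt V * sqrt V <= sd * sqrt V < sd (sd - a)], against the second tail bound. *)
  rewrite leNgt; apply/negP => hsd.
  suff : V w < sd * (sd - a) by rewrite ltNge hb2.
  rewrite -[V w](@sqr_sqrtr R)// expr2.
  apply: (@le_lt_trans _ _ (sd * Num.sqrt (V w))); first by rewrite ler_wpM2r//; lra.
  by rewrite ltr_pM2l; lra.
pose b := Num.sqrt (2 * L / m%:R).
have b0 : 0 <= b by exact: sqrtr_ge0.
have ba : b <= a.
  apply: ler_wsqrtr; rewrite ler_wpM2l ?mulr_ge0 ?(ltW L0)//.
  by rewrite lef_pV2 ?posrE// lerBlDr lerDl.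
have sqb (x : R) : 0 <= x -> Num.sqrt (2 * x * L / m%:R) = Num.sqrt x * b.
  by move=> x0; rewrite /b -sqrtrM//; congr Num.sqrt; ring.
rewrite sqb// -/sd in hb1; rewrite /good /= sqb//.
(* Replacing [sd] by [sqrt V + a] costs [a b <= a^2 = 2 L / (m - 1)], the summand 2 of the constant
   [7/3]; the other [1/3] is Bernstein's linear term. *)
have h1 : sd * b <= Num.sqrt (V w) * b + a ^+ 2.
  apply: (le_trans (ler_wpM2r b0 sdV)); rewrite mulrDl lerD2l expr2.
  by rewrite ler_wpM2l.
have h2 : L / (3 * m%:R) <= L / (3 * (m%:R - 1)).
  rewrite ler_wpM2l ?(ltW L0)// lef_pV2 ?posrE ?mulr_gt0//.
  by rewrite ler_pM2l// lerBlDr lerDl.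
have h3 : 7 * L / (3 * (m%:R - 1)) = a ^+ 2 + L / (3 * (m%:R - 1)).
  by rewrite a2; field; rewrite gt_eqF.
rewrite h3; lra.
Qed.
End concentration.

(** * Measurability of finite selections and scaling of sample statistics *)

Lemma measurable_tuple_bool (n : nat) (A : set (n.-tuple bool)) : measurable A.
Proof.
rewrite (_ : A = \bigcup_(o in A) [set o]); last first.
  by apply/seteqP; split=> [v Av|v [v' Av' -> //]]; exists v.
apply: fin_bigcup_measurable => [|o _].
  exact: finite_finset.
rewrite (_ : [set o] = \bigcap_(k in [set: 'I_n])
    ((fun o' : n.-tuple bool => tnth o' k) @^-1` [set tnth o k])).
  apply: fin_bigcap_measurable => [|k _]; first exact: finite_finset.
  by rewrite -[_ @^-1` _]setTI; exact: measurable_tnth.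
apply/seteqP; split=> [_ -> //|o' oo'].
by apply: eq_from_tnth => k; exact: oo'.
Qed.

(** Needed because the item at a given rank depends on the query. Splitting by the finitely many
    values of [S] writes the function as a sum of indicators times the [F k]. *)
Lemma measurable_fun_ord_select (R : realType) d (E : measurableType d) (n : nat)
    (S : E -> 'I_n) (F : 'I_n -> E -> R) :
    (forall k, measurable [set e | S e = k]) ->
    (forall k, measurable_fun setT (F k)) ->
  measurable_fun setT (fun e => F (S e) e).
Proof.
move=> mS mF.
rewrite (_ : (fun e => _) = (fun e => \sum_k \1_[set e | S e = k] e * F k e)).
  apply: measurable_sum => k; apply: measurable_funM => //.
apply/funext => e; rewrite (bigD1 (S e))//= indicE mem_set//= mul1r big1 ?addr0// => k kS.
by rewrite indicE memNset ?mul0r//= => Sk; rewrite Sk eqxx in kS.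
Qed.

Lemma measurable_fun_natr (R : realType) d (E : measurableType d) (b : E -> bool) :
  measurable_fun setT b -> measurable_fun setT (fun e => (b e)%:R : R).
Proof.
move=> mb; have -> : (fun e => (b e)%:R) = \1_(b @^-1` [set true]) :> (E -> R).
  apply/funext => e; rewrite indicE; congr (nat_of_bool _)%:R.
  by apply/idP/idP => [be|/set_mem//]; exact/mem_set.
by have := mb measurableT [set true] I; rewrite setTI; exact: measurable_indic.
Qed.

Lemma sample_meanZ (R : realType) (m : nat) (c : R) (z : 'I_m -> R) :
  sample_mean (fun i => c * z i) = c * sample_mean z.
Proof. by rewrite /sample_mean -mulr_sumr mulrCA. Qed.

Lemma sample_varianceZ (R : realType) (m : nat) (c : R) (z : 'I_m -> R) :
  sample_variance (fun i => c * z i) = c ^+ 2 * sample_variance z.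
Proof.
rewrite /sample_variance mulrCA; congr (_ * _); rewrite mulr_sumr.
apply: eq_bigr => i _; rewrite mulr_sumr; apply: eq_bigr => j _.
by rewrite -mulrBr exprMn.
Qed.

(** * The mean of the clipped statistic under the log law *)

Section log_data.
Variables (R : realType) (n : nat) (dQ : measure_display) (Q : measurableType dQ).
Variables (PQR : probability (Q * n.-tuple bool)%type R)
  (PO : R.-pker (Q * n.-tuple bool) ~> (n.-tuple bool)).

Let mPO (B : set (n.-tuple bool)) : measurable_fun setT (PO ^~ B).
Proof. by apply: measurable_kernel; exact: measurable_tuple_bool. Qed.

Let PO_fin (x : request Q n) (B : set (n.-tuple bool)) : PO x B \is a fin_num.
Proof.
rewrite ge0_fin_numE//; apply: (@le_lt_trans _ _ 1%E); last exact: ltry.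
rewrite -(prob_kernel (s := PO) x); apply: le_measure; rewrite ?inE//.
exact: measurable_tuple_bool.
Qed.

(** There are finitely many observation vectors, so conditional expectations given the request are
    finite sums; this puts the propensity in that form. *)
Lemma propensity_sum (x : request Q n) (k : 'I_n) :
  propensity PO x k = \sum_(o : n.-tuple bool) fine (PO x [set o]) * (tnth o k)%:R.
Proof.
have Efin : (PO x [set o : n.-tuple bool | tnth o k] =
    \sum_(o : n.-tuple bool) PO x [set o] * (tnth o k)%:R%:E)%E.
  rewrite -[X in PO x X]setIT -integral_indic//; last exact: measurable_tuple_bool.
  transitivity (\int[PO x]_v \sum_(o : n.-tuple bool)
      ((tnth o k)%:R%:E * (\1_[set o] v)%:E))%E.
    apply: eq_integral => v _; have v1 : \1_[set v] v = 1 :> R by rewrite indicE mem_set.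
    rewrite (bigD1 v)//= v1 mule1 big1 ?adde0 => [|o ov].
      rewrite indicE; congr (nat_of_bool _)%:R%:E.
      by apply/idP/idP => [/set_mem//|vk]; exact/mem_set.
    by rewrite indicE memNset ?mule0//= => vo; rewrite vo eqxx in ov.
  rewrite ge0_integral_sum//.
  - apply: eq_bigr => o _; rewrite ge0_integralZl// ?lee_fin//.
      by rewrite integral_indic ?setIT 1?muleC//; exact: measurable_tuple_bool.
    by apply/measurable_EFinP/measurable_indic; exact: measurable_tuple_bool.
  - move=> o; apply: measurable_funeM.
    by apply/measurable_EFinP/measurable_indic; exact: measurable_tuple_bool.
rewrite /propensity Efin.
have -> : (\sum_(o : n.-tuple bool) PO x [set o] * (tnth o k)%:R%:E =
    (\sum_(o : n.-tuple bool) fine (PO x [set o]) * (tnth o k)%:R)%:E)%E.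
  by rewrite -sumEFin; apply: eq_bigr => o _; rewrite EFinM fineK.
by [].
Qed.

(** Split according to the observation vector [o]. Where it is fixed, the integrand depends on the
    request alone, and the log law on the rectangles with second side [[set o]] is the hypothesis on
    indicators in [ge0_integral_weight_eq]. *)
Lemma has_log_law_integral dT (T : measurableType dT) (P : probability T R)
    (X : {RV P >-> ((Q * n.-tuple bool) * n.-tuple bool)%type})
    (f : log_entry Q n -> R) :
    has_log_law PQR PO X -> measurable_fun setT f -> (forall e, 0 <= f e) ->
  (\int[P]_w (f (X w))%:E =
   \sum_(o : n.-tuple bool) \int[PQR]_x (PO x [set o] * (f (x, o))%:E))%E.
Proof.
move=> lawX mf f0.
have mX : measurable_fun setT X by [].
have mfo o : measurable_fun setT (fun x : request Q n => f (x, o)).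
  by apply: (measurableT_comp mf); exact: measurable_fun_pair.
have m2 (o : n.-tuple bool) : measurable [set w | (X w).2 = o].
  have /(_ measurableT _ (measurable_tuple_bool [set o])) :
    measurable_fun setT (snd \o X) by exact: measurableT_comp.
  by rewrite setTI.
transitivity (\int[P]_w \sum_(o : n.-tuple bool)
   ((\1_[set w | (X w).2 = o] w)%:E * (f ((X w).1, o))%:E))%E.
  apply: eq_integral => w _; rewrite (bigD1 (X w).2)//= indicE mem_set//= mul1e.
  rewrite big1 ?adde0 => [|o oX]; first by rewrite -surjective_pairing.
  by rewrite indicE memNset ?mul0e//= => Xo; rewrite Xo eqxx in oX.
have mG (o : n.-tuple bool) : measurable_fun setT (fun w => (\1_[set w | (X w).2 = o] w)%:E : \bar R).
  by apply/measurable_EFinP; exact: measurable_indic.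
rewrite ge0_integral_sum//; last 2 first.
- move=> o; apply: emeasurable_funM => //; apply/measurable_EFinP.
  by apply: (measurableT_comp (mfo o)); exact: measurableT_comp.
- by move=> o w _; rewrite mule_ge0// lee_fin.
apply: eq_bigr => o _.
apply: (@ge0_integral_weight_eq _ _ _ P _ _ PQR _ _ (fun w => (X w).1) id
  (fun w => (\1_[set w | (X w).2 = o] w)%:E) (fun x => PO x [set o])
  _ _ _ _ _ _ _ _ _ (fun x => f (x, o))) => //.
- exact: measurableT_comp.
- move=> A mA; transitivity (P (X @^-1` (A `*` [set o]))).
    have mXA : measurable (X @^-1` (A `*` [set o])).
      rewrite -[_ @^-1` _]setTI; apply: mX => //; apply: measurableX => //.
      exact: measurable_tuple_bool.
    rewrite -[X @^-1` _ in RHS]setIT -integral_indic//.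
    apply: eq_integral => w _; rewrite -EFinM !indicE -natrM mulnb.
    by congr (nat_of_bool _)%:R%:E; apply/andP/idP => [[/set_mem/= ? /set_mem ?]|/set_mem[]];
      [exact/mem_set|split; exact/mem_set].
  rewrite lawX//; last exact: measurable_tuple_bool.
  rewrite [LHS]integral_mkcond; apply: eq_integral => x _.
  rewrite /patch indicE; case: ifP => _; first by rewrite mule1.
  by rewrite mule0.
Qed.

Let propensity_ge0 (x : request Q n) (k : 'I_n) : 0 <= propensity PO x k.
Proof. exact: fine_ge0. Qed.

Lemma measurable_propensity (k : 'I_n) :
  measurable_fun setT (fun x : request Q n => propensity PO x k).
Proof. exact: measurableT_comp. Qed.

Variables (sigma : Q -> nat -> 'I_n) (t : nat) (lambda : R).
Hypothesis lambda0 : 0 < lambda.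
Hypothesis msigma : forall j k, (1 <= j < t.+1)%N -> measurable [set q | sigma q j = k].
Hypothesis propensity_gt0 : forall (x : request Q n) j, (1 <= j < t.+1)%N ->
  0 < propensity PO x (sigma x.1 j).

Lemma measurable_Zstat : measurable_fun setT (Zstat PO sigma lambda t).
Proof.
rewrite /Zstat; under eq_fun do rewrite big_nat big_mkcond.
apply: measurable_sum => j; have [jt|_] := boolP (1 <= j < t.+1)%N; last exact: measurable_cst.
apply: (measurable_fun_ord_select (S := fun e : log_entry Q n => sigma e.1.1 j)
  (F := fun k e => Num.min lambda (1 / propensity PO e.1 k) * feedback R e k)) => k.
  have mfst2 : measurable_fun setT (fun e : log_entry Q n => e.1.1).
    exact: measurableT_comp.
  by have := mfst2 measurableT _ (msigma k jt); rewrite setTI.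
apply: measurable_funM.
  apply: measurable_minr => //.
  (* The item [k] is arbitrary here, so its propensity may vanish; the reciprocal and the power with
     exponent -1 are then both 0. *)
  rewrite (_ : (fun e => _) =
      (fun e : log_entry Q n => propensity PO e.1 k `^ (- 1))); last first.
    by apply/funext => e; rewrite div1r powR_inv1.
  apply: (measurableT_comp (measurable_powR (- 1))).
  exact: (measurableT_comp (measurable_propensity k)).
apply: measurable_funM; apply: measurable_fun_natr.
  exact: (measurableT_comp (measurable_tnth k)).
by apply: (measurableT_comp (measurable_tnth k)); exact: measurableT_comp.
Qed.

Lemma Zstat_ge0_le (e : log_entry Q n) :
  0 <= Zstat PO sigma lambda t e <= t%:R * lambda.
Proof.
have term j : (1 <= j < t.+1)%N -> 0 <= Num.min lambda
    (1 / propensity PO e.1 (sigma e.1.1 j)) * feedback R e (sigma e.1.1 j) <= lambda.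
  move=> jt; have p0 := propensity_gt0 e.1 jt.
  have min0 : 0 <= Num.min lambda (1 / propensity PO e.1 (sigma e.1.1 j)).
    by rewrite le_min (ltW lambda0) divr_ge0.
  rewrite /feedback mulr_ge0 ?mulr_ge0//= -natrM mulnb.
  case: (_ && _); last by rewrite mulr0 ltW.
  by rewrite mulr1 ge_min lexx.
rewrite /Zstat !big_nat; apply/andP; split.
  by apply: sumr_ge0 => j /term/andP[].
apply: (@le_trans _ _ (\sum_(1 <= j < t.+1) lambda)).
  by rewrite [leRHS]big_nat; apply: ler_sum => j /term/andP[].
by rewrite sumr_const_nat subn1 mulr_natl.
Qed.

(** Given the request, the observation of item [k] averages to its propensity [p], which leaves its
    relevance times [min(lambda, 1/p) p <= 1]. Clipping can thus only lower the mean. *)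
Lemma Zstat_conditional_mean (x : request Q n) :
  \sum_(o : n.-tuple bool) fine (PO x [set o]) * Zstat PO sigma lambda t (x, o) <=
  \sum_(1 <= j < t.+1) (tnth x.2 (sigma x.1 j))%:R.
Proof.
under eq_bigr do rewrite mulr_sumr.
rewrite exchange_big /= !big_nat; apply: ler_sum => j jt.
have p0 := propensity_gt0 x jt; set k := sigma x.1 j in p0 *.
rewrite (eq_bigr (fun o : n.-tuple bool =>
   (Num.min lambda (1 / propensity PO x k) * (tnth x.2 k)%:R) *
   (fine (PO x [set o]) * (tnth o k)%:R))); last first.
  by move=> o _; rewrite /feedback /= -/k; ring.
rewrite -mulr_sumr -propensity_sum mulrAC ler_piMl//.
by rewrite -ler_pdivlMr// ge_min lexx orbT.
Qed.

Let brel : bounded_measurable (fun x : request Q n =>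
  \sum_(1 <= j < t.+1) (tnth x.2 (sigma x.1 j))%:R : R).
Proof.
under eq_fun do rewrite big_nat big_mkcond.
apply: bounded_measurable_sum => j; have [jt|_] := boolP (1 <= j < t.+1)%N; last first.
  exact: bounded_measurable_cst.
split; last by exists 1 => x; rewrite normr_nat lern1 leq_b1.
apply: (measurable_fun_ord_select (S := fun x : request Q n => sigma x.1 j)
  (F := fun k x => (tnth x.2 k)%:R)) => k.
  have mfst : measurable_fun setT (fun x : request Q n => x.1) by exact: measurable_fst.
  by have := mfst measurableT _ (msigma k jt); rewrite setTI.
by apply: measurable_fun_natr; apply: (measurableT_comp (measurable_tnth k)).
Qed.

Lemma utility_fin_num : utility PQR sigma t \is a fin_num.
Proof.
rewrite /utility expectation.unlock.
exact/(integrable_fin_num measurableT)/bounded_measurable_integrable.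
Qed.

Lemma Zstat_mean_le_utility dT (T : measurableType dT) (P : probability T R)
    (X : {RV P >-> ((Q * n.-tuple bool) * n.-tuple bool)%type}) :
    has_log_law PQR PO X ->
  (\int[P]_w (Zstat PO sigma lambda t (X w))%:E <= utility PQR sigma t)%E.
Proof.
move=> lawX; have Z0 e : 0 <= Zstat PO sigma lambda t e by case/andP : (Zstat_ge0_le e).
have mZo o : measurable_fun setT (fun x : request Q n => Zstat PO sigma lambda t (x, o)).
  by apply: (measurableT_comp measurable_Zstat); exact: measurable_fun_pair.
have mterm (o : n.-tuple bool) : measurable_fun setT (fun x : request Q n =>
    (PO x [set o] * (Zstat PO sigma lambda t (x, o))%:E)%E).
  by apply: emeasurable_funM => //; exact/measurable_EFinP.
rewrite (has_log_law_integral lawX measurable_Zstat Z0) /utility expectation.unlock.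
apply: (@le_trans _ _ (\int[PQR]_x \sum_(o : n.-tuple bool)
    PO x [set o] * (Zstat PO sigma lambda t (x, o))%:E)%E).
  by rewrite ge0_integral_sum// => o x _; rewrite mule_ge0// lee_fin.
apply: ge0_le_integral => //.
- by move=> x _; apply: sume_ge0 => o _; rewrite mule_ge0// lee_fin.
- exact: emeasurable_sum.
- by apply/measurable_EFinP; case: brel.
- move=> x _; apply: le_trans (_ : (_ <= (\sum_(o : n.-tuple bool)
    fine (PO x [set o]) * Zstat PO sigma lambda t (x, o))%:E)%E) _.
    rewrite -sumEFin le_eqVlt; apply/orP; left; apply/eqP; apply: eq_bigr => o _.
    by rewrite EFinM fineK.
  by rewrite lee_fin; exact: Zstat_conditional_mean.
Qed.
End log_data.

(** * Transfer of the empirical Bernstein inequality to the logged data *)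

Theorem proposition4p5 (R : realType) (n : nat)
  (D : Type) (item : 'I_n -> D) (G : Type) (grp : G -> {set 'I_n})
  (dQ : measure_display) (Q : measurableType dQ)
  (f : Q -> D -> R) (hf : forall q x, 0 <= f q x <= 1)
  (sigma : Q -> G -> nat -> 'I_n)
  (hsigma : forall q g, is_ranking (fun j => f q (item j)) (grp g) (sigma q g))
  (msigma : forall g (j : nat) (k : 'I_n), (1 <= j <= #|grp g|)%N ->
     measurable [set q | sigma q g j = k])
  (tmax : G -> nat) (htmax : forall g, (1 <= tmax g <= #|grp g|)%N)
  (PQR : probability (Q * n.-tuple bool)%type R)
  (PO : R.-pker (Q * n.-tuple bool) ~> (n.-tuple bool))
  (hpos : exists2 gamma : R, 0 < gamma &
     forall (g : G) (x : request Q n) (j : nat), (1 <= j <= tmax g)%N ->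
       propensity PO x (sigma x.1 g j) > gamma)
  (m : nat) (hm : (1 < m)%N)
  (dT : measure_display) (T : measurableType dT) (P : probability T R)
  (X : 'I_m -> {RV P >-> ((Q * n.-tuple bool) * n.-tuple bool)%type})
  (hlaw : forall i, has_log_law PQR PO (X i))
  (hind : mutually_independent X)
  (lambda : R) (hlambda : 0 < lambda) (g : G)
  (t : nat) (ht : (1 <= t <= tmax g - 1)%N)
  (alpha : R) (halpha : 0 < alpha < 1) :
  ((1 - alpha)%:E <=
   P [set w | (utility PQR (fun q => sigma q g) t >=
               (U_lower PO (fun q => sigma q g) lambda t alpha
                  (fun i => X i w))%:E)%E])%E.
Proof.
have t_tmax : (t <= tmax g)%N by case/andP : ht => _ /leq_trans; apply; exact: leq_subr.
have msig j k : (1 <= j < t.+1)%N -> measurable [set q | sigma q g j = k].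
  rewrite ltnS => /andP[j1 jt]; apply: msigma; rewrite j1 (leq_trans jt)// (leq_trans t_tmax)//.
  by case/andP : (htmax g).
have pos (x : request Q n) j : (1 <= j < t.+1)%N -> 0 < propensity PO x (sigma x.1 g j).
  rewrite ltnS; case: hpos => gamma gamma0 hgamma /andP[j1 jt]; apply: (lt_trans gamma0).
  by apply: hgamma; rewrite j1 (leq_trans jt).
pose sg q := sigma q g; pose Z := Zstat PO sg lambda t.
have mZ : measurable_fun setT Z by exact: measurable_Zstat.
have Zb e : 0 <= Z e <= t%:R * lambda by exact: Zstat_ge0_le.
(* [b] bounds the range of [Z]; dividing by it, possible as [t >= 1], brings the values into
   [[0, 1]]. *)
pose b := t%:R * lambda; have b0 : 0 < b by rewrite mulr_gt0// ltr0n; case/andP : ht.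
pose h e := b^-1 * Z e.
have mh : measurable_fun setT h by exact: measurable_funM.
have h01 e : 0 <= h e <= 1.
  by have /andP[Z0 Z1] := Zb e; rewrite mulr_ge0 ?invr_ge0 ?(ltW b0)//= ler_pdivrMl// mulr1.
pose i0 : 'I_m := Ordinal (ltnW hm).
(* All entries follow the same log law, so their first and second moments agree with those of entry
   [i0]. *)
have same (k : log_entry Q n -> R) i : measurable_fun setT k -> (forall e, 0 <= k e) ->
    \int[P]_w k (X i w) = \int[P]_w k (X i0 w).
  by move=> mk k0; rewrite /Rintegral !(has_log_law_integral (hlaw _) mk k0).
have h0 e : 0 <= h e by case/andP : (h01 e).
have ufin := utility_fin_num PQR msig.
set u := utility PQR _ t; pose c := fine u / b.
have bhX : bounded_measurable (fun w => h (X i0 w)).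
  by split; [exact: measurableT_comp|exists 1 => w; rewrite ger0_norm//; case/andP : (h01 (X i0 w))].
have muc : \int[P]_w h (X i0 w) <= c.
  rewrite ler_pdivlMr// mulrC -bounded_measurable_RintegralZ//.
  have uE : ((fine u)%:E = u)%E by exact: fineK.
  rewrite -lee_fin uE /Rintegral fineK; last first.
    exact/(integrable_fin_num measurableT)/bounded_measurable_integrable/bounded_measurableM/bhX/bounded_measurable_cst.
  under eq_integral do rewrite mulVKf ?gt_eqF//.
  exact: Zstat_mean_le_utility.
have := @empirical_bernstein _ _ _ P _ _ m X h _ (\int[P]_w h (X i0 w) ^+ 2)
  hm hind mh h01 (fun i => same h i mh h0) _ alpha c halpha muc.
set A := [set w | _]; set B := [set w | _] => /(_ _)/le_trans; apply.
  by move=> i; apply: (same (fun e => h e ^+ 2)) => [|e]; [exact: measurable_funX|exact: sqr_ge0].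
suff -> : A = B by [].
have uE : ((fine u)%:E = u)%E by exact: fineK.
(* The lower bound is positively homogeneous: the variance scales by [b^-2], its root by [b^-1], and
   the last term of [U_lower] carries the factor [b = t lambda]. Both events therefore coincide. *)
have lowE w : sample_mean (fun i => h (X i w))
     - Num.sqrt (2 * sample_variance (fun i => h (X i w)) * ln (2 / alpha) / m%:R)
     - 7 * ln (2 / alpha) / (3 * (m%:R - 1)) =
    b^-1 * U_lower PO sg lambda t alpha (fun i => X i w).
  rewrite sample_meanZ sample_varianceZ /U_lower /U_CIPW -/Z !mulrBr; congr (_ - _ - _).
    rewrite -[X in X * Num.sqrt _]ger0_norm ?invr_ge0 ?(ltW b0)// -sqrtr_sqr.
    by rewrite -sqrtrM ?sqr_ge0//; congr Num.sqrt; ring.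
  have t0 : t%:R != 0 :> R by rewrite pnatr_eq0 -lt0n; case/andP : ht.
  have l0 : lambda != 0 by rewrite gt_eqF.
  have M0 : 3 * m%:R - 3 != 0 :> R.
    by rewrite -[X in _ - X]mulr1 -mulrBr mulf_neq0 ?subr_eq0 ?pnatr_eq1 ?gtn_eqF.
  rewrite /b; field.
  by rewrite t0 l0 M0.
have le_c w : (b^-1 * U_lower PO sg lambda t alpha (fun i => X i w) <= c) =
    (U_lower PO sg lambda t alpha (fun i => X i w) <= fine u).
  by rewrite /c [fine u / b]mulrC ler_pM2l// invr_gt0.
by apply/seteqP; split=> w; rewrite /A /B /= lowE le_c -uE lee_fin.
Qed.
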